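(* Let $R$ be a unital ring and let $M$ be a left (resp. right) $R$-module that is the union of finitely many proper left (resp. right) $R$-submodules. Then there exist a prime power $q$ and an integer $n \ge 1$ such that the covering number of $M$ by left (resp. right) $R$-submodules is $\frac{q^{n+1}-1}{q-1}$.
   Context: Rings are associative, not necessarily commutative. The covering number of a module $M$ by submodules is the minimum cardinality of a collection of proper submodules of $M$ whose set-theoretic union is $M$. *)

(* Defs.v *)
From mathcomp Require Import all_boot all_order all_algebra.
From mathcomp Require Import boolp classical_sets functions cardinality.
Set Implicit Arguments.
Unset Strict Implicit.
Unset Printing Implicit Defensive.

Import GRing.Theory.

Local Open Scope classical_set_scope.
Local Open Scope card_scope.

(* A right R-module is a left module over the converse ring R^c:
   for M : lmodType R^c, the right action x . a is a *: x, and scalerA reads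
   x . b . a = x . (b a), the product b a being taken in R.  The definitions
   below, stated for left modules, thus cover both sides. *)

Definition is_proper_submodule (R : pzRingType) (M : lmodType R)
    (A : set M) : Prop :=
  submod_closed (mem A) /\ A != [set: M].

Definition is_submodule_cover (R : pzRingType) (M : lmodType R)
    (C : set (set M)) : Prop :=
  (forall A, C A -> is_proper_submodule A) /\
  \bigcup_(A in C) A = [set: M].

(* The lower bound ranges over all covers, finite or infinite. *)
Definition is_covering_number (R : pzRingType) (M : lmodType R)
    (k : nat) : Prop :=
  (exists C : set (set M), is_submodule_cover C /\ C #= `I_k) /\
  (forall C : set (set M), is_submodule_cover C -> `I_k #<= C).

Definition prime_power (q : nat) : Prop :=
  exists p e : nat, [/\ prime p, (0 < e)%N & q = (p ^ e)%N].

(* Main.v *)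
Require Import Defs.
From HB Require Import structures.
From mathcomp Require Import boolp classical_sets functions cardinality.
From mathcomp Require Import all_boot all_algebra all_fingroup.
From mathcomp Require Import pgroup abelian.

Set Implicit Arguments.
Unset Strict Implicit.
Unset Printing Implicit Defensive.

Import GRing.Theory.
Local Open Scope ring_scope.

(** Let [M] be covered by finitely many proper submodules, as few as possible.
    No member can be dropped, and this makes the intersection of the members
    of finite index (Neumann): the covering number is that of a finite
    quotient ([irredundant_finite_index]), so let [M] be finite. For a simple
    module [S] let [D] be its endomorphism ring, a finite division ring
    with [q] elements; then [q] is a prime power and [#|S| = q ^ n] with
    [n >= 1]. Write [N] for [(q ^ n.+1 - 1) / (q - 1)]. Everything rests on
    counting the homomorphisms [M -> S], which form a left [D]-space. A maximal
    submodule with quotient [S] is the kernel of such a homomorphism, and two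
    nonzero homomorphisms with the same kernel differ by a factor in [D].

    Upper bound ([kernel_cover]). If there are at least [q ^ n.+1]
    homomorphisms, take a [D]-subspace [W] with exactly [q ^ n.+1] elements.
    Evaluation at a point maps [W] to the smaller set [S], hence is not
    injective, so every point lies in the kernel of a nonzero element of [W].
    There are at most [N] such kernels.

    Lower bound ([finite_cover_bounds]). Start from any cover, enlarge its
    members to maximal submodules, and pass to a submodule [K] of [M] and a
    subfamily [C] that covers [K], no member of which contains [K], with
    [#|K| + #|C|] minimal. Minimality of [K] forces every proper submodule of
    [K] into a member of [C]; so the kernels of the nonzero maps [K -> S] that
    extend to [M] are all cut out by members of [C]. If there are [q ^ k] such
    maps, the zero map included, then [C] has at least
    [(q ^ k - 1) / (q - 1)] members ([card_restr_homs_le]). Now let [S] be the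
    quotient of [M] by a member of [C]. Minimality of [C] gives a point of [K]
    that escapes all members of [C] with quotient not isomorphic to [S]; it can
    be translated by the intersection of those members, where each nonzero map
    to [S] takes every value equally often. A union bound over the
    [q ^ k - 1] nonzero maps then shows [q ^ n <= q ^ k - 1]
    ([card_restr_homs_gt]), that is [k >= n + 1], so that [C] has at least [N]
    members and the hypothesis of the upper bound holds as well. For a cover of
    minimum size the two bounds coincide.

    Submodules, homomorphisms and quotients see a ring only through the
    additive operators by which it acts. Finite modules are therefore modelled
    as finite abelian groups with a family of additive operators. *)

(** * Finite modules and finite quotients *)

HB.mixin Record isOpModule (Om : Type) M of FinRing.Zmodule M := {
  act : Om -> M -> M;
  actB : forall a, {morph act a : x y / x - y}
}.

#[short(type="opModType")]
HB.structure Definition OpModule (Om : Type) :=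
  {M of FinRing.Zmodule M & isOpModule Om M}.

Section EnumeratedModule.
Variables (Om : Type) (Z : zmodType) (op : Om -> Z -> Z).
Hypothesis opB : forall a, {morph op a : x y / x - y}.
Variables (s : seq Z) (mem_s : forall z, z \in s).

(** Carries the finite module structure of a group that is exhausted by a
    list; the proof of exhaustion is an argument of the type so that the
    structure can be inferred from the type alone. *)
Definition enumerated of (forall z, z \in s) : Type := Z.
Local Notation E := (enumerated mem_s).
HB.instance Definition _ := GRing.Zmodule.on E.
Let to_seq (z : E) : seq_sub s := SeqSub (mem_s z).
Let to_seqK : cancel to_seq (fun u => ssval u : E).
Proof. by []. Qed.
HB.instance Definition _ : isCountable E := CanIsCountable to_seqK.
HB.instance Definition _ : isFinite E := CanIsFinite to_seqK.
HB.instance Definition _ := isOpModule.Build Om E opB.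
Definition enumerated_opModType : opModType Om := E.
End EnumeratedModule.

Section QuotientModule.
Variables (Om : Type) (U : zmodType) (op : Om -> U -> U).
Hypothesis opB : forall a, {morph op a : x y / x - y}.

(** Stated with an explicit operator family on a possibly infinite group, since
    it serves both to pass from an arbitrary module to a finite one and to form
    simple quotients of a finite one. *)
Lemma finite_quotient (N : {pred U}) (X : seq U) :
    zmod_closed N -> (forall a x, x \in N -> op a x \in N) ->
    (forall x, exists2 y, y \in X & x - y \in N) ->
  exists (Q : opModType Om) (p : U -> Q),
    [/\ {morph p : x y / x - y}, forall a x, p (op a x) = act a (p x),
        forall q, exists x, p x = q & forall x, (p x == 0) = (x \in N)].
Proof.
move=> zN opN coverX.
pose I : zmodClosed U := HB.pack N (GRing.isZmodClosed.Build U N zN).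
pose Z : zmodType := Quotient.quot I.
pose p (x : U) : Z := (\pi_(Quotient.quot I) x)%qT.
have pB : {morph p : x y / x - y} by move=> x y; rewrite /p -[x - y]/(_ + _) piE.
have p_0 : p 0 = 0 by rewrite -(subrr 0) pB subrr.
have p0 x : (p x == 0) = (x \in N).
  by rewrite -p_0 -Quotient.idealrBE subr0.
have psurj q : exists x, p x = q by elim/quotW: q => x; exists x.
pose lift q := sval (cid (psurj q)).
have liftK q : p (lift q) = q by exact: svalP (cid (psurj q)).
pose op' a (q : Z) : Z := p (op a (lift q)).
have pop a x : p (op a x) = op' a (p x).
  by apply/eqP; rewrite -subr_eq0 -pB -opB p0 opN // -p0 pB liftK subrr.
have op'B a : {morph op' a : x y / x - y}.
  move=> q r; have [x <-] := psurj q; have [y <-] := psurj r.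
  by rewrite -pB -!pop opB pB.
have mem_s q : q \in map p X.
  have [x <-] := psurj q; have [y yX xyN] := coverX x.
  by rewrite (_ : p x = p y) ?map_f //; apply/eqP; rewrite -subr_eq0 -pB p0.
by exists (enumerated_opModType op'B mem_s), p.
Qed.
End QuotientModule.

(** * Submodules *)

Section Submodules.
Variables (Om : Type) (M : opModType Om).
Implicit Types (K L A B : {set M}) (x y : M).

Definition submodule K : Prop :=
  [/\ 0 \in K, {in K &, forall x y, x - y \in K} &
      forall a, {in K, forall x, act a x \in K}].

Definition maximal_submodule A : Prop :=
  [/\ submodule A, A != [set: M]%SET &
      forall B, submodule B -> A \subset B -> B != [set: M]%SET -> B = A].

Definition simple_module : Prop :=
  [set 0] != [set: M]%SET /\
  forall K, submodule K -> K != [set: M]%SET -> K = [set 0].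

Lemma act0 (a : Om) : act a (0 : M) = 0.
Proof. by rewrite -{1}(subrr 0) actB subrr. Qed.

Lemma actN (a : Om) x : act a (- x) = - act a x.
Proof. by rewrite -sub0r actB act0 sub0r. Qed.

Lemma actD (a : Om) x y : act a (x + y) = act a x + act a y.
Proof. by rewrite -{1}(opprK y) actB actN opprK. Qed.

Lemma submoduleN K x : submodule K -> x \in K -> - x \in K.
Proof. by case=> K0 KB _ Kx; rewrite -sub0r KB. Qed.

Lemma submoduleD K x y : submodule K -> x \in K -> y \in K -> x + y \in K.
Proof.
by move=> sK Kx Ky; rewrite -(opprK y); case: (sK) => _ KB _; rewrite KB ?submoduleN.
Qed.

Lemma submoduleT : submodule [set: M]%SET.
Proof. by split=> [|x y _ _|a x _]; rewrite inE. Qed.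

Lemma submoduleI K L : submodule K -> submodule L -> submodule (K :&: L).
Proof.
move=> [K0 KB Ka] [L0 LB La]; split=> [|x y|a x]; rewrite !inE ?K0 ?L0 //.
  by move=> /andP[Kx Lx] /andP[Ky Ly]; rewrite KB ?LB.
by move=> /andP[Kx Lx]; rewrite Ka ?La.
Qed.

Lemma submodule_sum K L : submodule K -> submodule L ->
  submodule [set x + y | x in K, y in L]%SET.
Proof.
move=> sK sL; have [K0 KB Ka] := sK; have [L0 LB La] := sL.
split=> [|_ _ /imset2P[x y Kx Ly ->] /imset2P[x' y' Kx' Ly' ->]|
         a _ /imset2P[x y Kx Ly ->]].
- by apply/imset2P; exists 0 0; rewrite ?addr0.
- by apply/imset2P; exists (x - x') (y - y'); rewrite ?KB ?LB // opprD addrACA.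
- by apply/imset2P; exists (act a x) (act a y); rewrite ?Ka ?La ?actD.
Qed.

Lemma maximal_sum A L x : maximal_submodule A -> submodule L ->
  ~~ (L \subset A) -> exists2 y, y \in L & x - y \in A.
Proof.
move=> [sA _ maxA] sL LnA.
have sAL := submodule_sum sA sL.
have [/eqP AL | ALnT] := boolP ([set y + z | y in A, z in L]%SET == [set: M]%SET).
  have := in_setT x; rewrite -AL => /imset2P[y z Ay Lz ->].
  by exists z; rewrite ?addrK.
have AL : [set y + z | y in A, z in L]%SET = A.
  apply: maxA => //; apply/subsetP=> y Ay; apply/imset2P.
  by exists y 0; rewrite ?addr0 //; case: sL.
case/negP: LnA; apply/subsetP=> z Lz; rewrite -AL; apply/imset2P.
by exists 0 z; rewrite ?add0r //; case: sA.
Qed.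

Lemma proper_sub_maximal K : submodule K -> K != [set: M]%SET ->
  exists2 A, maximal_submodule A & K \subset A.
Proof.
move=> sK KnT.
pose P B := [&& `[< submodule B >], B != [set: M]%SET & K \subset B].
have PK : P K by apply/and3P; split=> //; apply/asboolP.
have [A /maxsetP[/and3P[/asboolP sA AnT KA] maxA] _] := maxset_exists PK.
exists A => //; split=> // B sB AB BnT; apply: maxA => //.
by apply/and3P; split; [apply/asboolP | | apply: subset_trans AB].
Qed.

End Submodules.

(** * Homomorphisms *)

Section Homs.
Variable Om : Type.
Implicit Types M S : opModType Om.

Definition hom M S (f : M -> S) : Prop :=
  {morph f : x y / x - y} /\ forall a, {morph f : x / act a x}.

Definition homs M S : {set {ffun M -> S}} :=
  [set f : {ffun M -> S} | `[< hom f >]]%SET.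

Lemma homsP M S (f : {ffun M -> S}) : reflect (hom f) (f \in homs M S).
Proof. by rewrite inE; apply: asboolP. Qed.

Lemma hom0 M S (f : M -> S) : hom f -> f 0 = 0.
Proof. by case=> fB _; rewrite -{1}(subrr 0) fB subrr. Qed.

Lemma homN M S (f : M -> S) x : hom f -> f (- x) = - f x.
Proof. by move=> hf; rewrite -sub0r hf.1 (hom0 hf) sub0r. Qed.

Lemma homD M S (f : M -> S) x y : hom f -> f (x + y) = f x + f y.
Proof. by move=> hf; rewrite -{1}(opprK y) hf.1 (homN _ hf) opprK. Qed.

Definition ker M S (f : M -> S) : {set M} := [set x | f x == 0]%SET.

Lemma submodule_ker M S (f : M -> S) : hom f -> submodule (ker f).
Proof.
move=> hf; have [fB fa] := hf; split=> [|x y|a x]; rewrite !inE ?(hom0 hf) //.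
  by move=> /eqP fx /eqP fy; rewrite fB fx fy subrr.
by move=> /eqP fx; rewrite fa fx act0.
Qed.

Lemma submodule_im M S (f : M -> S) (K : {set M}) :
  hom f -> submodule K -> submodule (f @: K)%SET.
Proof.
move=> hf [K0 KB Ka]; have [fB fa] := hf.
split=> [|_ _ /imsetP[x Kx ->] /imsetP[y Ky ->]|a _ /imsetP[x Kx ->]].
- by apply/imsetP; exists 0; rewrite ?(hom0 hf).
- by rewrite -fB imset_f ?KB.
- by rewrite -fa imset_f ?Ka.
Qed.

Lemma hom_simple_onto M S (f : M -> S) (K : {set M}) x :
  simple_module S -> hom f -> submodule K -> x \in K -> f x != 0 ->
  forall s, exists2 y, y \in K & f y = s.
Proof.
move=> [_ simS] hf sK Kx fx s.
have sfK := submodule_im hf sK.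
have [/eqP fK | fKnT] := boolP (f @: K == [set: S])%SET.
  by have := in_setT s; rewrite -fK => /imsetP[y Ky ->]; exists y.
by move: (imset_f f Kx); rewrite (simS _ sfK fKnT) inE (negPf fx).
Qed.

(** Schur: on [K] the map [f] is onto [S], so [g] passes to the quotient by the
    kernel of [f], which is [S] itself. *)
Lemma hom_factor M S (f g : M -> S) (K : {set M}) x :
  simple_module S -> hom f -> hom g -> submodule K -> x \in K -> f x != 0 ->
  {in K, forall y, f y = 0 -> g y = 0} ->
  exists2 d, d \in homs S S & {in K, forall y, g y = d (f y)}.
Proof.
move=> simS hf hg sK Kx fx fg0; have [_ KB Ka] := sK.
have onto := hom_simple_onto simS hf sK Kx fx.
pose lift s := sval (cid2 (onto s)).
have liftK s : lift s \in K by rewrite /lift; case: cid2.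
have flift s : f (lift s) = s by rewrite /lift; case: cid2.
have glift y : y \in K -> g y = g (lift (f y)).
  move=> Ky; apply/eqP; rewrite -subr_eq0 -hg.1; apply/eqP; apply: fg0.
    by rewrite KB.
  by rewrite hf.1 flift subrr.
exists [ffun s => g (lift s)]; last by move=> y Ky; rewrite ffunE glift.
apply/homsP; split=> [s t|a s]; rewrite !ffunE.
  rewrite -hg.1 (glift (lift s - lift t)) ?KB //.
  by rewrite hf.1 !flift.
by rewrite -hg.2 (glift (act a (lift s))) ?Ka // hf.2 flift.
Qed.

(** Since [M = L + A], sending [y + a] to [g y] for [y] in [L] and [a] in [A] is
    well defined on [M], because [g] kills the trace of [A] on [L]. The kernel of
    this map contains [A]; as [g] is nonzero on [L], maximality of [A] makes them
    equal. *)
Lemma hom_extend M S (g : M -> S) (A L : {set M}) x :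
  hom g -> submodule L -> maximal_submodule A -> ~~ (L \subset A) ->
  {in L, forall y, y \in A -> g y = 0} -> x \in L -> g x != 0 ->
  exists2 h : {ffun M -> S}, h \in homs M S &
    ker h = A.
Proof.
move=> hg sL maxA LnA gA Lx gx; have [[A0 AB Aa] _ maxA'] := maxA.
have [_ LB La] := sL.
have dec y := maximal_sum y maxA sL LnA.
pose pr y := sval (cid2 (dec y)).
have prL y : pr y \in L by rewrite /pr; case: cid2.
have prA y : y - pr y \in A by rewrite /pr; case: cid2.
have gpr y z : z \in L -> y - z \in A -> g (pr y) = g z.
  move=> Lz yzA; apply/eqP; rewrite -subr_eq0 -hg.1; apply/eqP; apply: gA.
    by rewrite LB.
  have -> : pr y - z = (y - z) - (y - pr y) by rewrite opprB [RHS]addrC subrKA.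
  by rewrite AB.
pose h := [ffun y => g (pr y)].
have hh : hom h.
  split=> [y z|a y]; rewrite !ffunE.
    rewrite -hg.1; apply: gpr; first by rewrite LB.
    have -> : (y - z) - (pr y - pr z) = (y - pr y) - (z - pr z).
      by rewrite !opprB addrACA [RHS]addrACA [- z - _]addrC.
    by rewrite AB.
  by rewrite -hg.2; apply: gpr; rewrite ?La // -actB Aa.
have hL : {in L, h =1 g} by move=> y Ly; rewrite ffunE; apply: gpr; rewrite ?subrr.
exists h; first exact/homsP.
apply: maxA'; first exact: submodule_ker.
  apply/subsetP=> y Ay; rewrite inE ffunE (gpr y 0) ?(hom0 hg) ?subr0 //.
  by case: sL.
by apply: contraNneq gx => kerT; have := in_setT x; rewrite -kerT inE hL.
Qed.

End Homs.

(** * Linear algebra over the endomorphism ring of a simple module *)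

Section SimpleTarget.
Variables (Om : Type) (S : opModType Om).
Hypothesis simS : simple_module S.

Local Notation D := (homs S S).
Local Notation q := #|homs S S|.

(** Left [D]-subspaces of the functions from [T] to [S]. A plain finite set [T]
    is enough, which lets [T := unit] represent [S] as a space over [D]. *)
Definition subspace (T : finType) (U : {set {ffun T -> S}}) : Prop :=
  [/\ 0 \in U, {in U &, forall f g, f - g \in U} &
      {in D & U, forall (d : {ffun S -> S}) (f : {ffun T -> S}),
         [ffun t => d (f t)] \in U}].

Lemma subspaceD (T : finType) (U : {set {ffun T -> S}}) f g :
  subspace U -> f \in U -> g \in U -> f + g \in U.
Proof. by move=> [U0 UB _] Uf Ug; rewrite -(opprK g) UB // -sub0r UB. Qed.

Lemma subspace_homs (M : opModType Om) : subspace (homs M S).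
Proof.
split=> [|f g /homsP hf /homsP hg|d f /homsP hd /homsP hf]; apply/homsP.
- by split=> [x y|a x]; rewrite !ffunE ?subrr ?act0.
- split=> [x y|a x]; rewrite !ffunE; last by rewrite hf.2 hg.2 actB.
  by rewrite hf.1 hg.1 !opprB addrACA [RHS]addrACA [- f y + _]addrC.
- by split=> [x y|a x]; rewrite !ffunE ?hf.1 ?hd.1 ?hf.2 ?hd.2.
Qed.

Lemma endo_inj d s : d \in D -> d != 0 -> d s = 0 -> s = 0.
Proof.
move=> /homsP hd dn0 ds; apply/eqP.
have kerd : ker d = [set 0]%SET.
  apply: simS.2; first exact: submodule_ker.
  apply: contraNneq dn0 => kerT; apply/eqP/ffunP=> t; rewrite ffunE.
  by have := in_setT t; rewrite -kerT inE => /eqP.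
by rewrite -in_set1 -kerd inE ds.
Qed.

Lemma endo_inv d : d \in D -> d != 0 -> exists2 e, e \in D & cancel d e.
Proof.
move=> Dd dn0.
have [s ds] : exists s, d s != 0.
  apply/existsP; apply: contraNT dn0 => /existsPn d0.
  by apply/eqP/ffunP=> s; rewrite ffunE; apply/eqP; have := d0 s; rewrite negbK.
have hid : hom (id : S -> S) by [].
have dinj : {in [set: S]%SET, forall t, d t = 0 -> t = 0}.
  by move=> t _; apply: endo_inj.
have [e De de] := hom_factor simS (homsP _ Dd) hid (submoduleT S) (in_setT s) ds dinj.
by exists e => // t; rewrite -de ?inE.
Qed.

Lemma card_endo_gt1 : (1 < q)%N.
Proof.
have D0 : 0 \in D by case: (subspace_homs S).
have D1 : [ffun s => s] \in D by apply/homsP; split=> [x y|a x]; rewrite !ffunE.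
apply/card_gt1P; exists 0, [ffun s => s]; split=> //; case: simS => nT _.
apply: contraNneq nT => id0; apply/eqP/setP=> s; rewrite !inE.
by have /ffunP/(_ s) := id0; rewrite !ffunE => <-; rewrite eqxx.
Qed.

(** Adjoining a vector [f] outside [W] yields the sums [w + d f], and these are
    pairwise distinct because every nonzero [d] is invertible. *)
Lemma subspace_extend (T : finType) (U W : {set {ffun T -> S}}) :
    subspace U -> subspace W -> W \subset U -> W != U ->
  exists2 W' : {set {ffun T -> S}}, subspace W' &
    W' \subset U /\ #|W'| = (q * #|W|)%N.
Proof.
move=> sU sW WU WnU; have [U0 UB UD] := sU; have [W0 WB WD] := sW.
have [D0 DB DD] := subspace_homs S.
have [f Uf Wf] : exists2 f, f \in U & f \notin W.
  apply/exists_inP; rewrite -negb_forall_in; apply: contraNN WnU => /forall_inP UW.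
  by rewrite eqEsubset WU; apply/subsetP.
pose g (p : {ffun T -> S} * {ffun S -> S}) := p.1 + [ffun t => p.2 (f t)].
exists (g @: setX W D)%SET; last split.
- split=> [|_ _ /imsetP[[w d] /setXP[/= Ww Dd] ->] /imsetP[[v e] /setXP[/= Wv De] ->]|
           c _ Dc /imsetP[[w d] /setXP[/= Ww Dd] ->]].
  + apply/imsetP; exists (0, 0); first by apply/setXP.
    by apply/ffunP=> t; rewrite !ffunE addr0.
  + apply/imsetP; exists (w - v, d - e); first by apply/setXP; split; [apply: WB | apply: DB].
    by apply/ffunP=> t; rewrite !ffunE opprD addrACA.
  + apply/imsetP; exists ([ffun t => c (w t)], [ffun t => c (d t)]).
      by apply/setXP; split; [apply: WD | apply: DD].
    by apply/ffunP=> t; rewrite !ffunE (homD _ _ (homsP _ Dc)).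
- apply/subsetP=> _ /imsetP[[w d] /setXP[/= Ww Dd] ->].
  by apply: (subspaceD sU); [apply: (subsetP WU) | apply: UD].
rewrite card_in_imset ?cardsX 1?mulnC // => -[w d] [v e].
move=> /setXP[/= Ww Dd] /setXP[/= Wv De] /ffunP eqg.
have [dne|dne] := eqVneq (d - e) 0.
  have de : d = e by apply/eqP; rewrite -subr_eq0 dne.
  rewrite de; congr (_, _); apply/ffunP=> t.
  by have := eqg t; rewrite !ffunE de => /addIr.
have [c Dc cK] := endo_inv (DB _ _ Dd De) dne.
case/negP: Wf; suff -> : f = [ffun t => c ((v - w) t)] by rewrite WD ?WB.
apply/ffunP=> t; rewrite ffunE -[LHS]cK; congr (c _).
have := eqg t; rewrite !ffunE => ewv; apply/eqP.
by rewrite subr_eq addrAC eq_sym subr_eq -ewv addrC.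
Qed.

(** Replaces dimension theory over [D]: starting from the zero subspace, adjoin
    one vector at a time until [U] is exhausted. *)
Lemma subspace_filtration (T : finType) (U : {set {ffun T -> S}}) :
    subspace U ->
  exists2 k, #|U| = (q ^ k)%N &
    forall j, (j <= k)%N -> exists2 W : {set {ffun T -> S}},
      subspace W & W \subset U /\ #|W| = (q ^ j)%N.
Proof.
move=> sU; have [U0 _ _] := sU.
pose P j := `[< exists2 W : {set {ffun T -> S}},
  subspace W & W \subset U /\ #|W| = (q ^ j)%N >].
have P0 : P 0%N.
  apply/asboolP; exists [set (0 : {ffun T -> S})]%SET; last by rewrite sub1set cards1.
  split=> [|f g /set1P-> /set1P->|d f /homsP hd /set1P->]; apply/set1P=> //.
    exact: subrr.
  by apply/ffunP=> t; rewrite !ffunE (hom0 hd).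
have Pj j : P j -> (j < #|U|)%N.
  move=> /asboolP[W _ [/subset_leq_card WU Wj]].
  by apply: leq_trans (ltn_expl j card_endo_gt1) _; rewrite -Wj.
have [k Pk maxk] := ex_maxnP (ex_intro _ 0%N P0) (fun j Pj' => ltnW (Pj j Pj')).
have cardU : #|U| = (q ^ k)%N.
  move/asboolP: Pk => [W sW [WU Wk]]; rewrite -Wk.
  have [-> //|WnU] := eqVneq W U.
  have [W' sW' [W'U W'k]] := subspace_extend sU sW WU WnU.
  suff /maxk : P k.+1 by rewrite ltnn.
  by apply/asboolP; exists W'; rewrite // W'k Wk expnS.
exists k => //; elim=> [_|j IH jk]; first exact/asboolP.
have [W sW [WU Wj]] := IH (ltnW jk).
have WnU : W != U.
  apply: contraTneq jk => WeU.
  by rewrite -leqNgt -(leq_exp2l _ _ card_endo_gt1) -Wj -cardU WeU.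
have [W' sW' [W'U W'j]] := subspace_extend sU sW WU WnU.
by exists W'; rewrite // W'j Wj expnS.
Qed.

Lemma card_simple : exists2 n, (1 <= n)%N & #|S| = (q ^ n)%N.
Proof.
have sT : subspace [set: {ffun unit -> S}]%SET.
  by split=> [|f g _ _|d f _ _]; rewrite inE.
have [n + _] := subspace_filtration sT.
rewrite cardsT card_ffun card_unit expn1 => Sn; exists n => //.
rewrite lt0n; apply: contraNneq simS.1 => n0; rewrite eqEcard subsetT.
by rewrite cards1 cardsT Sn n0.
Qed.

(** The elements of [S] killed by a prime divisor [p] of the order of [S] form a
    nonzero submodule, hence all of [S], and the order of [S] is a power of [p].
    It is also a positive power of [q], so [q] divides a power of [p]. *)
Lemma card_simple_prime_power : prime_power q.
Proof.
have [n n_gt0 Sn] := card_simple.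
have [p p_pr pS] : exists2 p, prime p & forall s : S, s *+ p = 0.
  have S_gt1 : (1 < #|S|)%N by rewrite Sn -{1}(exp1n n) ltn_exp2r // card_endo_gt1.
  pose p := pdiv #|S|; have p_pr : prime p by rewrite pdiv_prime.
  have [|x _ ox] := Cauchy p_pr (_ : p %| #|[set: (S : finZmodType)]|)%N.
    by rewrite cardsT pdiv_dvd.
  exists p => //.
  have hp : hom (fun s : S => s *+ p).
    split=> [s t|a s]; first by rewrite mulrnBl.
    elim: (p) => [|m IH]; first by rewrite !mulr0n act0.
    by rewrite !mulrS IH actD.
  have kerp : ker (fun s : S => s *+ p) = [set: S]%SET.
    have [//|] := eqVneq (ker (fun s : S => s *+ p)) [set: S]%SET.
    move=> /(simS.2 _ (submodule_ker hp)) ker1.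
    have : x \in ker (fun s : S => s *+ p).
      by rewrite inE -(FinRing.zmodXgE p x) -ox expg_order.
    rewrite ker1 inE => /eqP x0; move: p_pr.
    by rewrite -ox x0 -FinRing.zmod1gE order1.
  by move=> s; have := in_setT s; rewrite -kerp inE => /eqP.
have pG : (p.-group [set: (S : finZmodType)])%g.
  suff : (p.-abelem [set: (S : finZmodType)])%g by apply: abelem_pgroup.
  rewrite abelemE // FinRing.zmod_abelian; apply/exponentP=> x _.
  by rewrite FinRing.zmodXgE pS.
have [m cS] := p_natP pG.
have : (q %| p ^ m)%N.
  by rewrite -cS cardsT Sn dvdn_exp.
case/(dvdn_pfactor _ _ p_pr) => e _ qe; exists p, e; split=> //.
by rewrite lt0n; apply: contraTneq card_endo_gt1 => e0; rewrite qe e0.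
Qed.
End SimpleTarget.

(** * Counting lemmas *)

Section Counting.
Variables (T T' : finType) (U : {set T}) (C : {set T'}) (phi : T -> T') (m : nat).

Lemma card_fiber_sum : {in U, forall x, phi x \in C} ->
  #|U| = (\sum_(A in C) #|[set x in U | phi x == A]|)%N.
Proof.
move=> UC; rewrite -sum1_card (partition_big phi (mem C)) //=.
by apply: eq_bigr => A _; rewrite -sum1_card; apply: eq_bigl => x; rewrite !inE.
Qed.

Lemma card_fibers_le : {in U, forall x, phi x \in C} ->
  (forall A, A \in C -> #|[set x in U | phi x == A]| <= m)%N ->
  (#|U| <= #|C| * m)%N.
Proof.
by move=> UC le_m; rewrite (card_fiber_sum UC) -sum_nat_const leq_sum.
Qed.

Lemma card_fibers_ge : {in U, forall x, phi x \in C} ->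
  (forall A, A \in C -> m <= #|[set x in U | phi x == A]|)%N ->
  (#|C| * m <= #|U|)%N.
Proof.
by move=> UC le_m; rewrite (card_fiber_sum UC) -sum_nat_const leq_sum.
Qed.

Lemma union_bound (N : {set T}) (B : T' -> {set T}) :
    (0 < #|N|)%N -> (forall i, i \in C -> #|B i| * m = #|N|)%N ->
    N \subset \bigcup_(i in C) B i ->
  (m <= #|C|)%N.
Proof.
move=> N_gt0 Bm NB; rewrite -(leq_pmul2l N_gt0).
apply: leq_trans (leq_mul (subset_leq_card NB) (leqnn m)) _.
have card_cup : (#|\bigcup_(i in C) B i| <= \sum_(i in C) #|B i|)%N.
  elim/big_rec2: _ => [|i c A _ le_c]; first by rewrite cards0.
  by apply: leq_trans (leq_card_setU _ _) _; rewrite leq_add2l.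
apply: leq_trans (leq_mul card_cup (leqnn m)) _.
rewrite big_distrl /= (eq_bigr (fun=> #|N|)) //.
by rewrite sum_nat_const mulnC.
Qed.
End Counting.

(** * Maps onto simple quotients *)

Section FiniteModule.
Variables (Om : Type) (M : opModType Om).

Lemma simple_quotient (A : {set M}) : maximal_submodule A ->
  exists S : opModType Om, simple_module S /\
    exists2 p, p \in homs M S & ker p = A.
Proof.
move=> [sA AnT maxA]; have [A0 AB Aa] := sA.
have zA : zmod_closed (mem A) by [].
have actM a : {morph act a : x y / x - y :> M} by exact: actB.
have covA x : exists2 y, y \in enum M & x - y \in mem A.
  by exists x; rewrite ?mem_enum // subrr.
have [S [p [pB pa psurj p0]]] := finite_quotient actM zA Aa covA.
have hp : hom p by split.
have pA x : (p x == 0) = (x \in A) by rewrite p0.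
exists S; split; last first.
  exists [ffun x => p x]; last by apply/setP=> x; rewrite inE ffunE pA.
  by apply/homsP; split=> [x y|a x]; rewrite !ffunE ?pB ?pa.
split=> [|K [K0 KB Ka] KnT].
  apply: contraNneq AnT => S0; apply/eqP/setP=> x.
  by rewrite -pA -in_set1 S0 !inE.
have -> : K = [set p x | x in p @^-1: K]%SET.
  apply/setP=> s; have [x <-] := psurj s; apply/idP/imsetP=> [Kx|[y + ->]].
    by exists x; rewrite ?inE.
  by rewrite inE.
rewrite (maxA (p @^-1: K)%SET).
- apply/setP=> s; rewrite inE; apply/imsetP/eqP=> [[x Ax ->]|->].
    by apply/eqP; rewrite pA.
  by exists 0; rewrite // (hom0 hp).
- split=> [|x y|a x]; rewrite !inE ?(hom0 hp) // ?pB ?pa; first exact: KB.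
  exact: Ka.
- by apply/subsetP=> x; rewrite -pA inE => /eqP->.
apply: contraNneq KnT => preT; apply/eqP/setP=> s; have [x <-] := psurj s.
by have := in_setT x; rewrite -preT !inE => ->.
Qed.

Lemma card_hom_fiber (S : opModType Om) (f : M -> S) (N : {set M}) x s :
  simple_module S -> hom f -> submodule N -> x \in N -> f x != 0 ->
  (#|[set y in N | f y == s]| * #|S|)%N = #|N|.
Proof.
move=> simS hf sN Nx fx; have [_ NB _] := sN.
have onto := hom_simple_onto simS hf sN Nx fx.
have eq_fib t : #|[set y in N | f y == t]| = #|[set y in N | f y == s]|.
  have [z Nz fz] := onto (t - s).
  rewrite -(card_imset [set y in N | f y == s] (addIr z)).
  apply: eq_card => y; rewrite inE; apply/andP/imsetP=> [[Ny /eqP fy]|].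
    exists (y - z); last by rewrite subrK.
    by rewrite inE NB // hf.1 fy fz subKr /=.
  case=> w; rewrite inE => /andP[Nw /eqP fw] ->.
  by rewrite submoduleD // (homD _ _ hf) fw fz addrC subrK.
have fT : {in N, forall y, f y \in [set: S]%SET} by move=> y _; rewrite inE.
rewrite (card_fiber_sum fT) (eq_bigr _ (fun t _ => eq_fib t)).
by rewrite sum_nat_const mulnC cardsT.
Qed.

End FiniteModule.

(** * Covers of a minimal submodule *)

Section LocalCover.
Variables (Om : Type) (M S : opModType Om) (K : {set M}) (C : {set {set M}}).
Hypotheses (simS : simple_module S) (sK : submodule K).
Hypotheses (maxC : {in C, forall A : {set M}, maximal_submodule A}).
Hypotheses (KnC : {in C, forall A : {set M}, ~~ (K \subset A)}).

Local Notation q := #|homs S S|.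

(** Extension by zero outside [K] keeps restrictions to [K] among the functions
    on [M], and makes equality of restrictions an equality of functions. *)
Definition restr (f : {ffun M -> S}) : {ffun M -> S} :=
  [ffun x => if x \in K then f x else 0].
Definition restr_homs : {set {ffun M -> S}} := (restr @: homs M S)%SET.

Lemma subspace_restr_homs : subspace restr_homs.
Proof.
have [H0 HB HD] := subspace_homs S M.
split=> [|_ _ /imsetP[f hf ->] /imsetP[g hg ->]|d _ Dd /imsetP[f hf ->]].
- apply/imsetP; exists 0 => //.
  by apply/ffunP=> x; rewrite !ffunE; case: ifP.
- apply/imsetP; exists (f - g); first exact: HB.
  by apply/ffunP=> x; rewrite !ffunE; case: ifP; rewrite ?subr0.
- apply/imsetP; exists [ffun x => d (f x)]; first exact: HD.
  apply/ffunP=> x; rewrite !ffunE; case: ifP => // _.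
  by rewrite (hom0 (homsP _ Dd)).
Qed.

Lemma restr_neq0 (f : {ffun M -> S}) : restr f != 0 -> exists2 x, x \in K & f x != 0.
Proof.
move=> rf; apply/exists_inP; apply: contraNT rf => /exists_inPn f0.
apply/eqP/ffunP=> x; rewrite !ffunE; case: ifP => // Kx.
by apply/eqP; have := f0 x Kx; rewrite negbK.
Qed.

(** Each nonzero restriction has its kernel in [K] contained in, hence equal to,
    the trace on [K] of a member of [C]. Restrictions attached to the same
    member have the same kernel, so by [hom_factor] they are nonzero multiples
    of each other, and there are at most [q - 1] of them. *)
Lemma card_restr_homs_le :
    (forall L, submodule L -> L \subset K -> L != K ->
       exists2 A, A \in C & L \subset A) ->
  (#|restr_homs| - 1 <= #|C| * (q - 1))%N.
Proof.
move=> minK; have [_ KB _] := sK; have [V0 _ _] := subspace_restr_homs.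
have cardV : (#|restr_homs| - 1)%N = #|restr_homs :\ (0 : {ffun M -> S})|%SET.
  by rewrite (cardsD1 (0 : {ffun M -> S}) restr_homs) V0 addKn.
have [D0 _ _] := subspace_homs S S.
have cardD : (q - 1)%N = #|homs S S :\ (0 : {ffun S -> S})|%SET.
  by rewrite (cardsD1 (0 : {ffun S -> S}) (homs S S)) D0 addKn.
(* The default value [set0] is never reached on nonzero restrictions. *)
pose phi (g : {ffun M -> S}) := odflt set0 [pick A in C | K :&: ker g \subset A].
have phiP g : g \in (restr_homs :\ (0 : {ffun M -> S}))%SET ->
    phi g \in C /\ K :&: ker g \subset phi g.
  case/setD1P=> gn0 /imsetP[f /homsP hf gf].
  rewrite /phi; case: pickP => [A /andP[] //|noA].
  have [x Kx fx] : exists2 x, x \in K & f x != 0 by apply: restr_neq0; rewrite -gf.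
  have [|||A AC LA] := minK (K :&: ker f).
  - exact: submoduleI (submodule_ker hf).
  - exact: subsetIl.
  - by apply: contraNneq fx => KIf; move: Kx; rewrite -KIf !inE => /andP[].
  have := noA A; rewrite AC (_ : K :&: ker g = K :&: ker f) ?LA //.
  by apply/setP=> y; rewrite !inE gf ffunE; case: (y \in K).
rewrite cardV; apply: (card_fibers_le (phi := phi)) => [g /phiP[] //|A AC].
have [->|[g0]] := set_0Vmem [set g in restr_homs :\ (0 : {ffun M -> S}) | phi g == A]%SET.
  by rewrite cards0.
rewrite inE => /andP[g0V /eqP phi0]; rewrite cardD.
have [f0A f0] : K :&: ker g0 \subset A /\ g0 != 0.
  by have [_] := phiP _ g0V; rewrite phi0; case/setD1P: g0V.
apply: leq_trans (leq_imset_card (fun d : {ffun S -> S} => [ffun x => d (g0 x)]) _).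
apply: subset_leq_card; apply/subsetP=> g; rewrite inE => /andP[gV /eqP phig].
have [_] := phiP _ gV; rewrite phig => gA.
case/setD1P: gV g0V f0A f0 gA => gn0 /imsetP[f hf gf] /setD1P[_ /imsetP[f1 hf1 gf1]].
move=> f1A; rewrite gf1 => f1n0 fA; have {hf}hf := homsP _ hf.
have {}hf1 := homsP _ hf1.
(* Otherwise [f] maps the trace of [A] onto [S], and then [K], whose
   part killed by [f] lies in [A], would be contained in [A]. *)
have kill x : x \in K -> x \in A -> f x = 0.
  move=> Kx Ax; apply/eqP/negPn/negP=> fx.
  have sAK : submodule (K :&: A) by apply: submoduleI => //; case: (maxC AC).
  have KAx : x \in K :&: A by rewrite inE Kx.
  case/negP: (KnC AC); apply/subsetP=> y Ky.
  have [z] := hom_simple_onto simS hf sAK KAx fx (f y).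
  rewrite inE => /andP[Kz Az] fz.
  have : y - z \in A.
    apply: (subsetP fA); rewrite !inE KB //= gf ffunE KB //.
    by rewrite hf.1 fz subrr.
  have [sA _ _] := maxC AC.
  by move=> yzA; rewrite -(subrK z y) submoduleD.
have [x Kx f1x] := restr_neq0 f1n0.
have f10 : {in K, forall y, f1 y = 0 -> f y = 0}.
  move=> y Ky f1y; apply: kill => //; apply: (subsetP f1A).
  by rewrite !inE Ky gf1 ffunE Ky f1y /=.
have [d Dd fd] := hom_factor simS hf1 hf sK Kx f1x f10.
apply/imsetP; exists d; last first.
  apply/ffunP=> y; rewrite gf !ffunE; case: ifP => [Ky|_]; first exact: fd.
  by rewrite (hom0 (homsP _ Dd)).
rewrite !inE in Dd *; rewrite Dd andbT; apply: contraNneq gn0 => d0.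
apply/eqP/ffunP=> y; rewrite gf !ffunE; case: ifP => // Ky.
by rewrite fd // d0 ffunE.
Qed.

(** The point [y] of [K] avoids all members of [C] whose trace on [K] is not the
    kernel of a map to [S], and so do its translates by the intersection [N2] of
    these members with [K]. As [C] covers [K], each translate is killed by a
    nonzero restriction. A restriction that is nonzero on [N2] kills only one
    translate in [#|S|], so at least [#|S|] nonzero restrictions are needed. *)
Lemma card_restr_homs_gt :
    K \subset cover C ->
    (forall T : {set {set M}}, T \proper C -> ~~ (K \subset cover T)) ->
    (exists2 A, A \in C & exists2 p, p \in homs M S & ker p = A) ->
  (#|S| < #|restr_homs|)%N.
Proof.
move=> covC irrC [A1 A1C [p hp kerp]].
pose typeS A := [exists f in homs M S, K :&: ker f == K :&: A]%SET.
pose T := [set A in C | ~~ typeS A]%SET.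
have TC : T \proper C.
  apply/properP; split; first by apply/subsetP=> A; rewrite inE => /andP[].
  exists A1 => //; rewrite inE A1C negbK; apply/existsP; exists p.
  by rewrite hp kerp eqxx.
have /subsetPn[y Ky yT] := irrC T TC.
pose N (s : seq {set M}) := (K :&: \bigcap_(A <- s) A)%SET.
have sN s : {subset s <= T} -> submodule (N s).
  move=> sT; apply: submoduleI => //; rewrite big_seq.
  elim/big_rec: _ => [|A B /sT]; first exact: submoduleT.
  by rewrite inE => /andP[/maxC[sA _ _] _]; apply: submoduleI.
(* If [g] first vanished upon intersecting with [A], then [A] would be the
   kernel of a map to [S] by [hom_extend], against the choice of [T]. *)
have nonzero (g : {ffun M -> S}) s : g \in homs M S -> restr g != 0 ->
    {subset s <= T} -> exists2 x, x \in N s & g x != 0.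
  move=> hg /restr_neq0[x Kx gx]; elim: s => [|A s IH] sT.
    by exists x; rewrite // /N big_nil !inE Kx.
  have sT' : {subset s <= T} by move=> B Bs; apply: sT; rewrite inE Bs orbT.
  have [z Nz gz] := IH sT'.
  have := sT A; rewrite inE eqxx => /(_ isT); rewrite inE => /andP[AC AnS].
  apply/exists_inP; apply: contraNT AnS => /exists_inPn gA0.
  have gA : {in N s, forall w, w \in A -> g w = 0}.
    move=> w; rewrite inE => /andP[Kw sw] Aw; apply/eqP; rewrite -[_ == _]negbK.
    by apply: gA0; rewrite /N big_cons !inE Kw Aw.
  have NnA : ~~ (N s \subset A).
    by apply: contraNN gz => /subsetP/(_ z Nz) Az; apply/eqP/gA.
  have [h hh kerh] :=
    hom_extend (homsP _ hg) (sN s sT') (maxC AC) NnA gA Nz gz.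
  by apply/existsP; exists h; rewrite hh kerh eqxx.
pose N2 := N (enum T).
have sub_enum : {subset enum T <= T} by move=> A; rewrite mem_enum.
have sN2 : submodule N2 by apply: sN.
have N2_gt0 : (0 < #|N2|)%N by apply/card_gt0P; exists 0; case: sN2.
have N2K x : x \in N2 -> x \in K by rewrite inE => /andP[].
have N2T x A : x \in N2 -> A \in T -> x \in A.
  rewrite inE big_enum => /andP[_ /bigcapP] NA; exact: NA.
have [V0 _ _] := subspace_restr_homs.
pose B (g : {ffun M -> S}) := [set x in N2 | g (x + y) == 0]%SET.
suff: (#|S| <= #|restr_homs :\ (0%R : {ffun M -> S})|)%N.
  by rewrite (cardsD1 (0 : {ffun M -> S}) restr_homs) V0.
apply: (union_bound (N := N2) (B := B)) => // [g|].
  case/setD1P=> gn0 /imsetP[f hf gf].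
  have [|x Nx fx] := nonzero f (enum T) hf _ sub_enum; first by rewrite -gf.
  rewrite -(card_hom_fiber (- f y) simS (homsP _ hf) sN2 Nx fx).
  congr (_ * _)%N; apply: eq_card => w; rewrite [LHS]inE [RHS]inE.
  have [Nw|//] := boolP (w \in N2).
  have Kwy : w + y \in K by apply: submoduleD => //; apply: N2K.
  by rewrite gf ffunE Kwy (homD _ _ (homsP _ hf)) addr_eq0.
apply/subsetP=> x Nx; apply/bigcupP.
have Kxy : x + y \in K by apply: submoduleD => //; apply: N2K.
have /bigcupP[A AC Axy] := subsetP covC _ Kxy.
have [sA _ _] := maxC AC.
have /existsP[f /andP[hf /eqP kerf]] : typeS A.
  apply: contraNT yT => AnS; have AT : A \in T by rewrite inE AC.
  apply/bigcupP; exists A => //; rewrite -(addKr x y) addrC.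
  by case: (sA) => _ AB _; rewrite AB // (N2T x).
exists (restr f).
  apply/setD1P; split; last by apply: imset_f.
  apply: contraNneq (KnC AC) => rf0; apply/subsetP=> w Kw.
  have : w \in K :&: A.
    rewrite -kerf !inE Kw; have /ffunP/(_ w) := rf0.
    by rewrite !ffunE Kw => ->; rewrite eqxx.
  by rewrite inE => /andP[].
rewrite inE Nx ffunE Kxy.
have : x + y \in K :&: A by rewrite inE Kxy.
by rewrite -kerf !inE => /andP[].
Qed.
End LocalCover.

(** * Covers of a finite module *)

Section FiniteCover.
Variables (Om : Type) (M : opModType Om).

Definition proper_cover (C : {set {set M}}) : Prop :=
  {in C, forall A : {set M}, submodule A /\ A != [set: M]%SET} /\
  cover C = [set: M]%SET.

(** By the pigeonhole principle evaluation at a point identifies two elements of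
    [W], a subspace with more elements than [S], and their difference vanishes
    at that point. *)
Lemma kernel_cover (S : opModType Om) n :
    simple_module S -> #|S| = (#|homs S S| ^ n)%N ->
    (#|homs S S| ^ n.+1 <= #|homs M S|)%N ->
  exists2 C : {set {set M}}, proper_cover C &
    (#|C| * (#|homs S S| - 1) <= #|homs S S| ^ n.+1 - 1)%N.
Proof.
move=> simS Sn leH; set q := #|homs S S| in Sn leH *.
have sH := subspace_homs S M.
have [k Hk /(_ n.+1)] := subspace_filtration simS sH.
rewrite -/q in Hk *; rewrite -(leq_exp2l _ _ (card_endo_gt1 simS)) -/q -Hk leH.
case=> // W sW [WH Wn]; have [W0 WB WD] := sW.
have cardW : (q ^ n.+1 - 1)%N = #|W :\ (0 : {ffun M -> S})|%SET.
  by rewrite -Wn (cardsD1 (0 : {ffun M -> S}) W) W0 addKn.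
have [D0 DB _] := subspace_homs S S.
have cardD : (q - 1)%N = #|homs S S :\ (0 : {ffun S -> S})|%SET.
  by rewrite /q (cardsD1 (0 : {ffun S -> S}) (homs S S)) D0 addKn.
have nzW f : f \in W -> f != 0 -> exists x, f x != 0.
  move=> Wf fn0; apply/existsP; apply: contraNT fn0 => /existsPn f0.
  apply/eqP/ffunP=> x; rewrite ffunE; apply/eqP.
  by have := f0 x; rewrite negbK.
exists [set ker f | f : {ffun M -> S} in W :\ (0 : {ffun M -> S})]%SET.
  split=> [_ /imsetP[f /setD1P[fn0 Wf] ->]|].
    have hf := homsP _ (subsetP WH _ Wf).
    split; first exact: submodule_ker.
    have [x fx] := nzW f Wf fn0; apply: contraNneq fx => kerT.
    by have := in_setT x; rewrite -kerT inE.
  apply/setP=> x; rewrite inE; apply/bigcupP.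
  apply/exists_inP; apply: contraT => /exists_inPn noker.
  have inj_ev : {in W &, injective (fun f : {ffun M -> S} => f x)}.
    move=> f g Wf Wg fg; apply/eqP; rewrite -subr_eq0; apply/negPn/negP=> fgn0.
    have Wfg : f - g \in (W :\ (0 : {ffun M -> S}))%SET by rewrite !inE fgn0 WB.
    by have := noker _ (imset_f _ Wfg); rewrite inE !ffunE fg subrr eqxx.
  have := max_card (mem [set f x | f : {ffun M -> S} in W]%SET).
  rewrite card_in_imset // Wn Sn leq_exp2l ?ltnn //; exact: card_endo_gt1.
(* The [q - 1] nonzero multiples of a map share its kernel. *)
rewrite cardW cardD; apply: (card_fibers_ge (phi := fun f : {ffun M -> S} => ker f)).
  by move=> f Wf; apply: imset_f.
move=> _ /imsetP[f /setD1P[fn0 Wf] ->].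
have [x fx] := nzW f Wf fn0.
pose post (d : {ffun S -> S}) : {ffun M -> S} := [ffun y => d (f y)].
have post0 d y : d \in homs S S -> d != 0 -> (post d y == 0) = (f y == 0).
  move=> Dd dn0; rewrite ffunE; apply/eqP/eqP=> [|->].
    exact: endo_inj Dd dn0.
  exact: hom0 (homsP _ Dd).
rewrite -(card_in_imset (f := post)).
  apply: subset_leq_card; apply/subsetP=> _ /imsetP[d /setD1P[dn0 Dd] ->].
  rewrite !inE WD // andbT; apply/andP; split.
    by apply: contraNneq fx => pd0; rewrite -(post0 d) // pd0 ffunE.
  by apply/eqP/setP=> y; rewrite !inE post0.
move=> d e /setD1P[_ Dd] /setD1P[_ De] /ffunP/(_ x); rewrite !ffunE => de.
apply/eqP; rewrite -subr_eq0; apply/negPn/negP=> den0.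
case/negP: fx; apply/eqP; apply: (endo_inj simS (DB _ _ Dd De) den0).
by rewrite !ffunE de subrr.
Qed.

Lemma maximal_cover (C : {set {set M}}) : proper_cover C ->
  exists2 C' : {set {set M}}, (#|C'| <= #|C|)%N &
    cover C' = [set: M]%SET /\ {in C', forall A : {set M}, maximal_submodule A}.
Proof.
move=> [propC covC].
pose up (A : {set M}) := if pselect (exists2 B : {set M}, maximal_submodule B & A \subset B)
             is left e then sval (cid2 e) else A.
have upP A : A \in C -> maximal_submodule (up A) /\ A \subset up A.
  move=> /propC[sA AnT]; rewrite /up; case: pselect => [e|[]].
    by case: (cid2 e).
  exact: proper_sub_maximal.
exists (up @: C)%SET; first exact: leq_imset_card.
split; last by move=> _ /imsetP[A /upP[mA _] ->].
apply/setP=> x; have := in_setT x; rewrite -{1}covC => /bigcupP[A AC Ax].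
rewrite inE; apply/bigcupP; exists (up A); first exact: imset_f.
by have [_ /subsetP->] := upP A AC.
Qed.

(** The pair [(q, n)] depends on the cover [C]. Applied to a cover of minimum
    size, the two inequalities determine that size. *)
Theorem finite_cover_bounds (C : {set {set M}}) : proper_cover C ->
  exists q n (C' : {set {set M}}), [/\ prime_power q, (1 <= n)%N,
    proper_cover C' & (#|C'| <= (q ^ n.+1 - 1) %/ (q - 1) <= #|C|)%N].
Proof.
move=> /maximal_cover[C1 leC1 [covC1 maxC1]].
pose P (p : {set M} * {set {set M}}) :=
  [&& `[< submodule p.1 >], p.2 \subset C1, p.1 \subset cover p.2
    & [forall A in p.2, ~~ (p.1 \subset A)]].
have PT : P ([set: M]%SET, C1).
  apply/and4P; split=> //=; first exact/asboolP/submoduleT.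
    by rewrite covC1.
  by apply/forall_inP=> A /maxC1[_ + _]; rewrite subTset.
(* Minimizing the sum makes both components minimal, each for the other. *)
pose weight (p : {set M} * {set {set M}}) := (#|p.1| + #|p.2|)%N.
case: (arg_minnP weight PT) => -[K C2] /and4P[/asboolP/= sK C21 KC2 /forall_inP KnC2] minKC.
have maxC2 : {in C2, forall A : {set M}, maximal_submodule A}.
  by move=> A /(subsetP C21)/maxC1.
have minK (L : {set M}) : submodule L -> L \subset K -> L != K ->
    exists2 A, A \in C2 & L \subset A.
  move=> sL LK LnK; apply/exists_inP; apply: contraNT LnK => /exists_inPn LnC.
  rewrite eqEcard LK -(leq_add2r #|C2|); apply: (minKC (L, C2)).
  apply/and4P; split=> //=; first exact/asboolP.
    exact: subset_trans KC2.
  exact/forall_inP.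
have irrC (T : {set {set M}}) : T \proper C2 -> ~~ (K \subset cover T).
  move=> TC; apply/negP=> KT; have := proper_card TC; rewrite ltnNge => /negP; apply.
  rewrite -(leq_add2l #|K|); apply: (minKC (K, T)).
  have TC2 := proper_sub TC.
  apply/and4P; split=> //=; first exact/asboolP.
    exact: subset_trans C21.
  by apply/forall_inP=> A /(subsetP TC2); apply: KnC2.
have [A1 A1C _] : exists2 A, A \in C2 & 0 \in A.
  by case: sK => /(subsetP KC2) /bigcupP.
have [S [simS exp]] := simple_quotient (maxC2 A1 A1C).
have [n n_gt0 Sn] := card_simple simS.
set q := #|homs S S| in Sn *.
have q_gt1 : (1 < q)%N := card_endo_gt1 simS.
have leC2 := card_restr_homs_le simS sK maxC2 KnC2 minK.
have := card_restr_homs_gt simS sK maxC2 KnC2 KC2 irrC (ex_intro2 _ _ A1 A1C exp).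
have [k Vk _] := subspace_filtration simS (subspace_restr_homs S K).
rewrite -/q in leC2 Vk; rewrite Sn Vk ltn_exp2l // => lt_nk.
have leH : (q ^ n.+1 <= #|homs M S|)%N.
  apply: leq_trans (leq_imset_card (restr K) (homs M S)).
  by rewrite -/(restr_homs S K) Vk leq_exp2l.
have [C' covC' leC'] := kernel_cover simS Sn leH.
exists q, n, C'; split=> //; first exact: card_simple_prime_power.
rewrite leq_divRL ?subn_gt0 // leC' /=; apply: leq_trans leC1.
apply: leq_trans (subset_leq_card C21).
rewrite -(mulnK #|C2| (_ : 0 < q - 1)%N) ?subn_gt0 //; apply: leq_div2r.
by apply: leq_trans leC2; rewrite Vk leq_sub2r // leq_exp2l.
Qed.
End FiniteCover.

(** * Reduction to a finite quotient *)

Section FiniteIndex.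
Variables (U : zmodType) (m : nat) (F : 'I_m -> set U).
Hypothesis FB : forall i x y, F i x -> F i y -> F i (x - y).
Hypothesis covF : forall x, exists i, F i x.
Hypothesis irrF : forall J : {set 'I_m}, J != [set: 'I_m]%SET ->
  exists x, forall i, i \in J -> ~ F i x.

(** Downward induction on [J]: the intersection of the [F i] for [i] in [J] is
    covered by finitely many cosets of the total intersection. Take [x0] outside
    all [F i] with [i] in [J]. If [x] lies in the intersection over [J], then
    [x0 + x] lies in some [F i] with [i] not in [J], and for each such [i] all
    these [x] lie in one coset of the intersection over [i |: J]. *)
Lemma irredundant_finite_index :
  exists X : seq U, forall x, exists2 y, y \in X & forall i, F i (x - y).
Proof.
suff fin_index k (J : {set 'I_m}) : (#|~: J| < k)%N ->
    exists X : seq U, forall x, (forall i, i \in J -> F i x) ->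
      exists2 y, y \in X & forall i, F i (x - y).
  have [X XP] := fin_index _ set0 (ltnSn _).
  by exists X => x; apply: XP => i; rewrite inE.
elim: k J => // k IH J; rewrite ltnS => Jk.
have [->|/irrF[x0 Jx0]] := eqVneq J [set: 'I_m]%SET.
  exists [:: 0] => x Fx; exists 0; rewrite ?inE // => i.
  by rewrite subr0; apply: Fx; rewrite inE.
have cosets i : exists X : seq U, i \notin J -> forall x,
    (forall j, j \in J -> F j x) -> F i (x0 + x) ->
    exists2 y, y \in X & forall j, F j (x - y).
  have [iJ|niJ] := boolP (i \in J); first by exists [::].
  have [|X XP] := IH (i |: J)%SET.
    apply: leq_trans Jk; apply: proper_card; rewrite properC.
    by apply: properUr; rewrite sub1set.
  have [[h [Jh ih]]|noh] := pselect (exists h, (forall j, j \in J -> F j h) /\ F i (x0 + h)).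
    exists [seq h + y | y <- X] => _ x Jx ix.
    have [j /setU1P[->|jJ]|y Xy Fy] := XP (x - h).
    - by have := FB ix ih; rewrite opprD addrACA subrr add0r.
    - by apply: FB; [apply: Jx | apply: Jh].
    exists (h + y); first exact: map_f.
    by move=> j; rewrite opprD addrA.
  by exists [::] => _ x Jx ix; case: noh; exists x.
have [X XP] := choice cosets.
exists (flatten [seq X i | i <- enum 'I_m]) => x Jx.
have [i ix] := covF (x0 + x).
have niJ : i \notin J.
  apply/negP=> iJ; apply: (Jx0 i iJ).
  by rewrite -(addrK x x0); apply: FB => //; apply: Jx.
have [y Xy Fy] := XP i niJ x Jx ix.
by exists y => //; apply/flatten_mapP; exists i; rewrite ?mem_enum.
Qed.
End FiniteIndex.

Section CoveringNumber.
Variables (R : pzRingType) (M : lmodType R).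

Definition indexed_cover m (F : 'I_m -> set M) : Prop :=
  (forall i, is_proper_submodule (F i)) /\ forall x, exists i, F i x.

Lemma set_submodP (A : set M) : submod_closed (mem A) <->
  A 0 /\ forall a x y, A x -> A y -> A (a *: x + y).
Proof.
split=> [[A0 AS]|[A0 AS]].
  split=> [|a x y Ax Ay]; first by rewrite -in_setE.
  by rewrite -in_setE; apply: AS; rewrite in_setE.
split=> [|a x y]; first by rewrite in_setE.
by rewrite !in_setE; apply: AS.
Qed.

Lemma indexed_cover_of_set (C : set (set M)) k :
  is_submodule_cover C -> (C #= `I_k)%card ->
  exists F : 'I_k -> set M, indexed_cover F.
Proof.
move=> [propC covC]; rewrite card_eq_sym => /card_set_bijP[f [fC _ Cf]].
exists (fun i => f i); split=> [i|x]; first by apply: propC; apply: fC => /=.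
have : [set: M]%classic x by [].
by rewrite -covC => -[A /Cf[i /= ik <-] Ax]; exists (Ordinal ik).
Qed.

Lemma set_cover_of_indexed m (F : 'I_m -> set M) : indexed_cover F ->
  is_submodule_cover (range F) /\ (range F #<= `I_m)%card.
Proof.
move=> [propF covF]; split.
  split=> [_ [i _ <-]//|]; apply/seteqP; split=> // x _.
  by have [i Fx] := covF x; exists (F i) => //; exists i.
by apply: card_le_trans (card_image_le _ _) _; have := @card_II m; rewrite card_eq_le => /andP[].
Qed.

(** Infinite covers are bounded below for free, and finite ones can be
    indexed. *)
Lemma is_covering_number_min m (F : 'I_m -> set M) :
    indexed_cover F ->
    (forall k (G : 'I_k -> set M), indexed_cover G -> (m <= k)%N) ->
  is_covering_number M m.
Proof.
move=> covF minF; have [covC leC] := set_cover_of_indexed covF.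
have lower (C : set (set M)) : is_submodule_cover C -> (`I_m #<= C)%card.
  move=> cC; have [/finite_setP[k Ck]|] := pselect (finite_set C).
    have [G /minF mk] := indexed_cover_of_set cC Ck.
    by rewrite (card_le_eqr Ck) card_le_II.
  by move=> /infiniteP; apply: card_le_trans; apply: subset_card_le.
split=> //; exists (range F); split=> //.
by rewrite card_eq_le leC lower.
Qed.

Lemma irredundant_min m (F : 'I_m -> set M) (J : {set 'I_m}) :
    indexed_cover F ->
    (forall k (G : 'I_k -> set M), indexed_cover G -> (m <= k)%N) ->
    J != [set: 'I_m]%SET ->
  exists x, forall i, i \in J -> ~ F i x.
Proof.
move=> [propF covF] minF JnT; apply: contrapT => noX.
have : indexed_cover (fun j : 'I_#|J| => F (enum_val j)).
  split=> [j|x]; first exact: propF.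
  apply: contrapT => nox; apply: noX; exists x => i iJ Fx; apply: nox.
  by exists (enum_rank_in iJ i); rewrite enum_rankK_in.
move/minF; rewrite leqNgt; apply/negP/negPn.
by rewrite -[X in (_ < X)%N]card_ord -cardsT proper_card // properT.
Qed.

(** The intersection of a minimum cover has finite index, so this cover descends
    to a proper cover of a finite quotient of [M], while proper covers of the
    quotient pull back to covers of [M] without growing. *)
Theorem covering_number (C : set (set M)) :
    is_submodule_cover C -> finite_set C ->
  exists q n, [/\ prime_power q, (1 <= n)%N &
    is_covering_number M ((q ^ n.+1 - 1) %/ (q - 1))%N].
Proof.
move=> covC /finite_setP[k0 Ck0].
pose P m := `[< exists F : 'I_m -> set M, indexed_cover F >].
have exP : exists m, P m.
  exists k0; apply/asboolP; exact: indexed_cover_of_set covC Ck0.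
have [m /asboolP[F covF] minP] := ex_minnP exP.
have minF k (G : 'I_k -> set M) : indexed_cover G -> (m <= k)%N.
  by move=> cG; apply: minP; apply/asboolP; exists G.
have [propF inF] := covF.
have subF i := (set_submodP (F i)).1 (propF i).1.
have F0 i : F i 0 by have [] := subF i.
have FS i a x y : F i x -> F i y -> F i (a *: x + y).
  by have [_] := subF i; apply.
have FB i x y : F i x -> F i y -> F i (x - y).
  by move=> Fx Fy; rewrite addrC -scaleN1r; apply: FS.
have [X XP] := irredundant_finite_index FB inF (fun J => irredundant_min covF minF).
pose N : {pred M} := [pred x | `[< forall i, F i x >]].
have NP x : reflect (forall i, F i x) (x \in N) by apply: asboolP.
have zN : zmod_closed N.
  split=> [|x y /NP Nx /NP Ny]; apply/NP => // i.
  exact: FB.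
have opN (a : R) x : x \in N -> a *: x \in N.
  by move=> /NP Nx; apply/NP=> i; rewrite -[_ *: _]addr0; apply: FS.
have covN x : exists2 y, y \in X & x - y \in N.
  by have [y Xy Fy] := XP x; exists y => //; apply/NP.
have opB (a : R) : {morph *:%R a : x y / x - y :> M} by exact: scalerBr.
have [Q [p [pB pa psurj p0]]] := finite_quotient opB zN opN covN.
have p_0 : p 0 = 0 by rewrite -(subrr 0) pB subrr.
have pD x y : p (x + y) = p x + p y.
  by rewrite -{1}(opprK y) pB -sub0r pB p_0 sub0r opprK.
have Fp i x y : p x = p y -> F i x -> F i y.
  move=> /eqP; rewrite eq_sym -subr_eq0 -pB p0 => /NP Nxy Fx.
  by rewrite -(subrK x y) -[y - x]scale1r; apply: FS.
pose im i : {set Q} := [set s | `[< exists2 x, F i x & p x = s >]]%SET.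
have imP i x : reflect (F i x) (p x \in im i).
  rewrite inE; apply: (iffP (asboolP _)) => [[y Fy pyx]|Fx].
    exact: Fp Fy.
  by exists x.
have cov_im : proper_cover [set im i | i : 'I_m]%SET.
  split=> [_ /imsetP[i _ ->]|].
    split; first split.
    - by rewrite -p_0; apply/imP.
    - move=> s t; have [x <-] := psurj s; have [y <-] := psurj t.
      by move=> /imP Fx /imP Fy; rewrite -pB; apply/imP/FB.
    - move=> a s; have [x <-] := psurj s => /imP Fx; rewrite -pa; apply/imP.
      by rewrite -[_ *: _]addr0; apply: FS.
    apply/negP=> /eqP imT; have [_ /eqP] := propF i; apply.
    by apply/seteqP; split=> // x _; apply/imP; rewrite imT inE.
  apply/setP=> s; rewrite inE; have [x <-] := psurj s; have [i Fx] := inF x.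
  by apply/bigcupP; exists (im i); [apply: imset_f | apply/imP].
have [q [n [C' [q_pp n_gt0 [propC' covC'] /andP[C'le leC']]]]] :=
  finite_cover_bounds cov_im.
exists q, n; split=> //; suff <- : m = ((q ^ n.+1 - 1) %/ (q - 1))%N.
  exact: is_covering_number_min covF minF.
apply/eqP; rewrite eqn_leq; apply/andP; split; last first.
  apply: leq_trans leC' _; apply: leq_trans (leq_imset_card _ _) _.
  by rewrite card_ord.
apply: leq_trans C'le.
apply: (minF _ (fun j : 'I_#|C'| => [set x | p x \in enum_val j]%classic)).
split=> [j|x].
  have [[A0 AB Aa] AnT] := propC' _ (enum_valP j); split.
    apply/set_submodP; split=> [|a x y /= Ax Ay]; first by rewrite /= p_0.
    by rewrite /= pD pa; apply: submoduleD => //; apply: Aa.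
  apply: contra_neqN AnT => /eqP preT; apply/setP=> s.
  have [x <-] := psurj s; rewrite inE.
  by have : [set: M]%classic x by []; rewrite -preT.
have := in_setT (p x); rewrite -covC' => /bigcupP[A AC Ax].
by exists (enum_rank_in AC A); rewrite /= enum_rankK_in.
Qed.

End CoveringNumber.

Theorem theorem1p5 (R : pzRingType) :
  (forall M : lmodType R,
     (exists C : set (set M), is_submodule_cover C /\ finite_set C) ->
     exists q n : nat, [/\ prime_power q, (1 <= n)%N &
       is_covering_number M ((q ^ n.+1 - 1) %/ (q - 1))%N]) /\
  (forall M : lmodType R^c,
     (exists C : set (set M), is_submodule_cover C /\ finite_set C) ->
     exists q n : nat, [/\ prime_power q, (1 <= n)%N &
       is_covering_number M ((q ^ n.+1 - 1) %/ (q - 1))%N]).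
Proof. by split=> M [C [covC finC]]; apply: covering_number covC finC. Qed.
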